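(* Let $f\colon X\to Y$ be a continuous map between finite connected $T_0$ topological spaces. Then $\mathrm{scat}(\mathcal{K}(f))\leq \mathrm{cat}(f)$.
   Context: A finite $T_0$-space $X$ is identified with a finite poset by $x\le y$ iff $U_x\subseteq U_y$, where $U_x$ is the intersection of all open sets containing $x$. $\mathcal{K}(X)$ is the simplicial complex whose vertices are the points of $X$ and whose simplices are the nonempty finite chains of this poset. A continuous map $f\colon X\to Y$ between finite $T_0$-spaces induces the simplicial map $\mathcal{K}(f)\colon \mathcal{K}(X)\to\mathcal{K}(Y)$ given on vertices by $\mathcal{K}(f)(x)=f(x)$. For a continuous map $f\colon X\to Y$, $\mathrm{cat}(f)$ is the classical Lusternik--Schnirelmann category: the least integer $n\ge0$ such that $X$ is covered by open sets $U_0,\dots,U_n$ with each $f|_{U_j}\colon U_j\to Y$ homotopic to a constant map. Simplicial complexes are abstract, finite and (edge-path) connected; subcomplexes of a given complex (e.g. members of covers) are not required to be connected. Simplicial maps $f,g\colon K\to L$ are contiguous, $f\sim_c g$, if $f(\sigma)\cup g(\sigma)$ is a simplex of $L$ for every simplex $\sigma$ of $K$. They are in the same contiguity class, $f\sim g$, if there are simplicial maps $f=f_0\sim_c f_1\sim_c\cdots\sim_c f_m=g$ from $K$ to $L$. $f\sim *$ means $f\sim c$ for some map $c$ sending all vertices to a single vertex of $L$. $\mathrm{scat}(f)$ is the least integer $n\ge 0$ such that $K$ is a union of subcomplexes $U_0,\dots,U_n$ with $f|_{U_j}\sim *$ (as maps $U_j\to L$) for all $0\le j\le n$. *)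

(* Defs.v *)
From mathcomp Require Import all_boot all_order all_algebra finmap.
From mathcomp Require Import all_classical all_reals all_analysis.
Import Order.TTheory GRing.Theory Num.Theory.
Import numFieldNormedType.Exports.
Set Implicit Arguments.
Unset Strict Implicit.
Unset Printing Implicit Defensive.

Local Open Scope classical_set_scope.
Local Open Scope ring_scope.

(* The least element of S, with the convention that it is +oo when S is empty.
   The extended integers are used only as the target of the order. *)
Definition least (S : set nat) : \bar int :=
  if pselect (exists n, `[< S n >]) is left h then (Posz (ex_minn h))%:E
  else +oo%E.

Section lusternik_schnirelmann.
Context (R : realType) {X Y : topologicalType}.

(* The restrictions f|_A and g|_A are homotopic: H is continuous on
   A x [0, 1], and its values elsewhere are irrelevant. *)
Definition homotopic_on (A : set X) (f g : X -> Y) : Prop :=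
  exists H : X * R -> Y,
    [/\ {within A `*` `[0, 1], continuous H},
        forall x, A x -> H (x, 0) = f x &
        forall x, A x -> H (x, 1) = g x].

Definition ls_cat (f : X -> Y) : \bar int :=
  least [set n | exists U : 'I_n.+1 -> set X,
    [/\ forall j, open (U j),
        \bigcup_j U j = [set: X] &
        forall j, exists y : Y, homotopic_on (U j) f (cst y)]].

End lusternik_schnirelmann.

(* Not every point of V need be a vertex: v is a vertex when [fset v] is a
   simplex, and a subcomplex is again a complex over V. Neither finiteness nor
   connectedness is built in: members of a cover may be disconnected or empty,
   and the order complex of a finite connected space has both properties. *)
Record complex (V : choiceType) := Complex {
  simplices : set {fset V};
  simplex_neq0 : forall s, simplices s -> s != fset0;
  simplex_face : forall s t, simplices s -> t != fset0 -> (t `<=` s)%fset ->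
    simplices t
}.

Section simplicial_maps.
Context {V W : choiceType}.

(* The underlying function is defined on all of V, but only its values on the
   vertices of K matter. *)
Record simplicial_map (K : complex V) (L : complex W) := SimplicialMap {
  vertex_map :> V -> W;
  map_simplex : forall s, simplices K s -> simplices L (vertex_map @` s)%fset
}.

Definition simplicial_restrict (K U : complex V) (L : complex W)
    (UK : simplices U `<=` simplices K)
    (f : simplicial_map K L) : simplicial_map U L :=
  @SimplicialMap U L f (fun s Us => map_simplex f (UK s Us)).

Section contiguity.
Context {K : complex V} {L : complex W}.
Implicit Types f g : simplicial_map K L.

Definition contiguous f g : Prop :=
  forall s, simplices K s -> simplices L ((f @` s) `|` (g @` s))%fset.

Definition same_contiguity_class f g : Prop :=
  exists (m : nat) (h : nat -> simplicial_map K L),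
    [/\ h 0%N = f, h m = g &
        forall i, (i < m)%N -> contiguous (h i) (h i.+1)].

Definition constant_map f : Prop :=
  exists2 w : W, simplices L [fset w]%fset &
    forall v, simplices K [fset v]%fset -> f v = w.

Definition class_trivial f : Prop :=
  exists2 c : simplicial_map K L, constant_map c & same_contiguity_class f c.

End contiguity.

Definition scat (K : complex V) (L : complex W) (f : simplicial_map K L) :
    \bar int :=
  least [set n | exists (U : 'I_n.+1 -> complex V)
                        (UK : forall j, simplices (U j) `<=` simplices K),
    \bigcup_j simplices (U j) = simplices K /\
    forall j, class_trivial (simplicial_restrict (UK j) f)].

End simplicial_maps.

Section order_complex.
Context {X : topologicalType}.

Definition minimal_open (x : X) : set X :=
  \bigcap_(U in [set U : set X | open U /\ U x]) U.

Definition spec_le (x y : X) : Prop := minimal_open x `<=` minimal_open y.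

Definition chains : set {fset X} :=
  [set s | s != fset0 /\
    forall x y, x \in s -> y \in s -> spec_le x y \/ spec_le y x].

Lemma chain_neq0 s : chains s -> s != fset0.
Proof. by case. Qed.

Lemma chain_face s t :
  chains s -> t != fset0 -> (t `<=` s)%fset -> chains t.
Proof.
move=> [_ sc] t0 /fsubsetP ts; split=> // x y /ts xs /ts ys; exact: sc.
Qed.

End order_complex.

Definition order_complex (X : topologicalType) : complex X :=
  Complex (@chain_neq0 X) (@chain_face X).

Section order_complex_map.
Context {X Y : topologicalType} (f : X -> Y) (cf : continuous f).

Lemma spec_le_continuous x y : spec_le x y -> spec_le (f x) (f y).
Proof.
move=> xy z fxz U [oU Ufy]; apply: fxz; split=> //.
have yx : minimal_open y x by apply: xy => V [].
apply: (yx (f @^-1` U)); split=> //; apply: open_comp => // w _; exact: cf.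
Qed.

Lemma chain_image s :
  simplices (order_complex X) s -> simplices (order_complex Y) (f @` s)%fset.
Proof.
move=> [s0 sc]; split.
  have /fset0Pn[x xs] := s0; apply/fset0Pn; exists (f x); exact: in_imfset.
move=> _ _ /imfsetP[x /= xs ->] /imfsetP[y /= ys ->].
by have [] := sc _ _ xs ys => /spec_le_continuous; [left|right].
Qed.

Definition order_complex_map :
    simplicial_map (order_complex X) (order_complex Y) :=
  SimplicialMap chain_image.

End order_complex_map.

(* Main.v *)
(** A homotopy H on U x [0, 1] between finite spaces satisfies
    H(x', s) <= H(x, t) whenever x' <= x and s is close enough to t, because the
    minimal open set of H(x, t) is open. Hence every H(-, t) is monotone on U and
    H(-, s) <= H(-, t) for s close to t. Comparable monotone maps lie in the same
    contiguity class (pass from one to the other one level of the poset at a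
    time), so the contiguity class of H(-, t) is locally constant in t, and it is
    constant since [0, 1] is connected. *)
Require Import Defs.
From mathcomp Require Import all_boot all_order all_algebra finmap.
From mathcomp Require Import all_classical all_reals all_analysis.
Import Order.TTheory GRing.Theory Num.Theory.
Import numFieldNormedType.Exports.
Set Implicit Arguments.
Unset Strict Implicit.
Unset Printing Implicit Defensive.

Local Open Scope classical_set_scope.

(** * Least elements, and propagation along the unit interval *)

Lemma le_least (S T : set nat) : S `<=` T -> (least T <= least S)%E.
Proof.
move=> ST; rewrite /least.
case: pselect => [hT|nT]; case: pselect => [hS|nS]; rewrite ?leey //.
  rewrite lee_fin lez_nat; case: ex_minnP => m _ minT; case: ex_minnP => n Sn _.
  by apply: minT; apply/asboolP/ST/asboolP.
by case: nT; case: hS => n /asboolP/ST Tn; exists n; apply/asboolP.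
Qed.

(** The trace of [P] on [I] is nonempty and both relatively open and relatively closed, so it is all
    of [I]. Since [P] is controlled only on [I], the complement of [I] is adjoined before taking
    interiors. *)
Lemma segment_locally_constant (R : realType) (P : set R) :
  (forall t : R, `[0%R, 1%R]%classic t ->
    \forall s \near t, `[0%R, 1%R]%classic s -> (P s <-> P t)) ->
  P 0%R -> P 1%R.
Proof.
set I : set R := `[0%R, 1%R]%classic => locP P0.
have I0 : I 0%R by rewrite /I /= in_itv /= lexx ler01.
have I1 : I 1%R by rewrite /I /= in_itv /= lexx ler01.
suff IE : I `&` P = I by move: I1; rewrite -IE => -[].
apply: (@segment_connected R 0%R 1%R); first by exists 0%R.
- exists (~` I `|` P)^°; first exact: open_interior.
  apply/seteqP; split=> t [It].
    move=> Pt; split=> //; apply: filterS (locP t It) => s PsPt.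
    by have [Is|nIs] := pselect (I s); [right; apply/(PsPt Is)|left].
  by move=> /nbhs_singleton [].
- exists (~` (~` I `|` ~` P)^°); first exact/open_closedC/open_interior.
  apply/seteqP; split=> t [It].
    by move=> Pt; split=> // /nbhs_singleton [].
  move=> nt; split=> //; apply: contrapT => nPt; apply: nt.
  apply: filterS (locP t It) => s PsPt.
  by have [Is|nIs] := pselect (I s); [right=> /(PsPt Is)|left].
Qed.

(** * Contiguity classes form an equivalence relation *)

Section contiguity_classes.
Context {V W : choiceType} {K : complex V} {L : complex W}.
Implicit Types f g h : simplicial_map K L.

Lemma contiguous_sym f g : contiguous f g -> contiguous g f.
Proof. by move=> fg s Ks; rewrite fsetUC; exact: fg. Qed.

Lemma contiguous_same_class f g : contiguous f g -> same_contiguity_class f g.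
Proof.
move=> fg; exists 1%N, (fun i => if i is 0%N then f else g); split=> //.
by case.
Qed.

Lemma same_class_refl f : same_contiguity_class f f.
Proof. by exists 0%N, (fun=> f). Qed.

Lemma same_class_sym f g :
  same_contiguity_class f g -> same_contiguity_class g f.
Proof.
move=> [m [h [h0 hm hc]]]; exists m, (fun i => h (m - i)%N).
split; rewrite ?subn0 ?subnn // => i im.
apply: contiguous_sym; rewrite -(subnSK im); apply: hc.
by rewrite subnSK// leq_subr.
Qed.

Lemma same_class_trans g f h : same_contiguity_class f g ->
  same_contiguity_class g h -> same_contiguity_class f h.
Proof.
move=> [m [a [a0 am ac]]] [n [b [b0 bn bc]]].
exists (m + n)%N, (fun i => if (i <= m)%N then a i else b (i - m)%N); split=> //.
  (* The endpoint [m + n] falls in the first half only when [n] is 0; then [g] and [h] coincide. *)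
  case: leqP => [|_]; last by rewrite addKn.
  by rewrite -leq_subRL// subnn leqn0 => /eqP n0; rewrite n0 addn0 am -b0 -bn n0.
move=> i imn; case: (ltngtP i m) => im; first exact: ac.
  by rewrite subSn 1?ltnW//; apply: bc; rewrite ltn_subLR// ltnW.
by rewrite im subSnn am -b0; apply: bc; rewrite -(ltn_add2l m) addn0 -{1}im.
Qed.

End contiguity_classes.

(** * The specialization order of a finite space *)

Section specialization_order.
Context {X : topologicalType}.
Implicit Types x y z : X.

Lemma minimal_open_id x : minimal_open x x.
Proof. by move=> U []. Qed.

Lemma spec_leP x y : spec_le x y <-> minimal_open y x.
Proof.
split; first by apply; exact: minimal_open_id.
by move=> yx z xz U [oU Uy]; apply: xz; split=> //; exact: yx.
Qed.

Lemma spec_le_refl x : spec_le x x.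
Proof. by []. Qed.

Lemma spec_le_trans y x z : spec_le x y -> spec_le y z -> spec_le x z.
Proof. by move=> xy yz; exact: subset_trans yz. Qed.

Lemma open_spec_le (U : set X) x y : open U -> spec_le x y -> U y -> U x.
Proof. by move=> oU /spec_leP yx Uy; apply: yx. Qed.

Hypothesis finX : finite_set [set: X].

(** The complement is the union of the closures of its points: if [w] in [minimal_open x] were in
    the closure of [z], every open set around [x] would contain [w], hence [z]. Finiteness makes
    this union closed. *)
Lemma minimal_open_open x : open (minimal_open x).
Proof.
rewrite -[minimal_open x]setCK; apply: closed_openC.
suff -> : ~` minimal_open x = \bigcup_(z in ~` minimal_open x) closure [set z].
  apply: closed_bigcup => [|z _]; last exact: closed_closure.
  exact: sub_finite_set finX.
apply/seteqP; split=> [z xz|w [z xz zw] xw].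
  by exists z => //; exact: subset_closure.
apply: xz => U [oU Ux]; have Uw : nbhs w U.
  by apply: open_nbhs_nbhs; split=> //; exact: xw.
by have [_ [-> ]] := zw _ Uw.
Qed.

(** Serves as a height function: it grows along the order, strictly except between equivalent
    points. *)
Definition rank x : nat := #|` fset_set (minimal_open x)|.

Lemma finite_minimal_open x : finite_set (minimal_open x).
Proof. exact: sub_finite_set finX. Qed.

Lemma spec_le_rank x y : spec_le x y -> (rank x <= rank y)%N.
Proof.
by move=> xy; apply: fsubset_leq_card; rewrite -fset_set_sub//;
  exact: finite_minimal_open.
Qed.

Lemma spec_le_rank_eq x y : spec_le x y -> rank x = rank y -> spec_le y x.
Proof.
move=> xy rxy.
have /eqP xyE : fset_set (minimal_open x) == fset_set (minimal_open y).
  rewrite eqEfcard -/(rank x) -/(rank y) rxy leqnn andbT.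
  by rewrite -fset_set_sub//; exact: finite_minimal_open.
rewrite /spec_le fset_set_sub; [|exact: finite_minimal_open..].
by rewrite xyE.
Qed.

Lemma chain_max (s : {fset X}) : chains s ->
  exists2 m, m \in s & forall x, x \in s -> spec_le x m.
Proof.
move=> [/fset0Pn[x0 x0s] sc].
have [m _ maxm] :=
  @arg_maxnP s [` x0s]%fset xpredT (fun x : s => rank (fsval x)) isT.
exists (fsval m) => [|x xs]; first exact: fsvalP.
have [//|mx] := sc _ _ xs (fsvalP m).
apply: spec_le_rank_eq => //; apply/eqP; rewrite eqn_leq spec_le_rank//=.
exact: (maxm [` xs]%fset).
Qed.

End specialization_order.

(** * Comparable monotone maps on a subset *)

Section comparable_maps.
Context {X Y : topologicalType} (A : set X).

(** The order is that of [X], not of the subspace topology on [A], so these chains are simplices of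
    [order_complex X] by construction. *)
Definition subspace_chains : set {fset X} :=
  [set s | chains s /\ forall x, x \in s -> A x].

Lemma subspace_chain_neq0 s : subspace_chains s -> s != fset0.
Proof. by case=> /chain_neq0. Qed.

Lemma subspace_chain_face s t :
  subspace_chains s -> t != fset0 -> (t `<=` s)%fset -> subspace_chains t.
Proof.
move=> [sc sA] t0 ts; split; first exact: chain_face ts.
by move=> x /(fsubsetP ts)/sA.
Qed.

Definition subspace_complex : complex X :=
  Complex subspace_chain_neq0 subspace_chain_face.

Definition monotone_on (g : X -> Y) : Prop :=
  forall x y, A x -> A y -> spec_le x y -> spec_le (g x) (g y).

Lemma monotone_on_chains g : monotone_on g -> forall s,
  simplices subspace_complex s -> simplices (order_complex Y) (g @` s)%fset.
Proof.
move=> mg s [[/fset0Pn[x0 x0s] sc] sA]; split.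
  by apply/fset0Pn; exists (g x0); exact: in_imfset.
move=> _ _ /imfsetP[x /= xs ->] /imfsetP[y /= ys ->].
by have [] := sc _ _ xs ys => /mg; [left|right]; auto.
Qed.

Definition monotone_map g (mg : monotone_on g) :
    simplicial_map subspace_complex (order_complex Y) :=
  SimplicialMap (monotone_on_chains mg).

(** The images of a chain under [f] and under [g] are chains already, so only mixed pairs need
    comparing. *)
Lemma monotone_contiguous
    (f g : simplicial_map subspace_complex (order_complex Y)) :
    (forall x y, A x -> A y -> spec_le x y ->
      (spec_le (f x) (g y) \/ spec_le (g y) (f x)) /\
      (spec_le (f y) (g x) \/ spec_le (g x) (f y))) ->
  contiguous f g.
Proof.
move=> fg s Ks; have [_ fc] := map_simplex f Ks; have [_ gc] := map_simplex g Ks.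
have fgc x y : x \in s -> y \in s ->
    spec_le (f x) (g y) \/ spec_le (g y) (f x).
  have [[_ sc] sA] := Ks => xs ys.
  by have [] := sc _ _ xs ys => /fg[]; auto.
split.
  have /fset0Pn[x xs] := simplex_neq0 Ks.
  by apply/fset0Pn; exists (f x); rewrite in_fsetU in_imfset.
move=> a b; rewrite !in_fsetU => /orP[af|ag] /orP[bf|bg];
  [exact: fc| | |exact: gc].
  by case/imfsetP: af => x /= xs ->; case/imfsetP: bg => y /= ys ->; exact: fgc.
case/imfsetP: ag => x /= xs ->; case/imfsetP: bf => y /= ys ->.
by have [] := fgc _ _ ys xs; auto.
Qed.

Hypothesis finX : finite_set [set: X].

Section switch.
Variables f g : X -> Y.
Hypotheses (mf : monotone_on f) (mg : monotone_on g).
Hypothesis fg : forall x, A x -> spec_le (f x) (g x).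

(* f and g themselves need not be contiguous: for x <= y in a chain, f y and g x
   may be incomparable. Lowering the threshold k by one only affects one level of
   the rank, where comparable points are equivalent. *)
Let switch k x := if (k <= rank x)%N then g x else f x.

Let switch_monotone k : monotone_on (switch k).
Proof.
move=> x y Ax Ay xy; rewrite /switch; have rxy := spec_le_rank finX xy.
case: (leqP k (rank x)) => [kx|xk]; first by rewrite (leq_trans kx rxy); exact: mg.
case: ifP => _; last exact: mf.
by apply: (spec_le_trans (fg Ax)); exact: mg.
Qed.

Let switch_contiguous k :
  contiguous (monotone_map (@switch_monotone k.+1))
    (monotone_map (@switch_monotone k)).
Proof.
have down x : A x -> spec_le (switch k.+1 x) (switch k x).
  move=> Ax; rewrite /switch; case: (ltnP k (rank x)) => [kx|_].
    by rewrite (ltnW kx).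
  by case: ifP => _; [exact: fg|exact: spec_le_refl].
apply: monotone_contiguous => x y Ax Ay xy /=; split.
  left; apply: spec_le_trans (down _ Ax) _; exact: switch_monotone.
(* The two maps can differ at [x] only when [rank x] is [k]. *)
have [rxk|rxk] := eqVneq (rank x) k; last first.
  right; suff -> : switch k x = switch k.+1 x by exact: switch_monotone.
  by rewrite /switch [in LHS]leq_eqVlt eq_sym (negPf rxk).
have rxy := spec_le_rank finX xy.
rewrite /switch rxk leqnn; case: (ltnP k (rank y)) => [_|ryk].
  by right; exact: mg.
(* Here [x] and [y] both have rank [k], so [y] is also below [x] and [f y <= g y <= g x]. *)
left; apply: spec_le_trans (fg Ay) _; apply: mg => //.
apply: spec_le_rank_eq => //; apply/eqP; rewrite eqn_leq rxy.
by rewrite rxk ryk.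
Qed.

Lemma spec_le_same_class
    (F G : simplicial_map subspace_complex (order_complex Y)) :
  F = f :> (X -> Y) -> G = g :> (X -> Y) -> same_contiguity_class F G.
Proof.
have same_fun (M N : simplicial_map subspace_complex (order_complex Y)) :
    M =1 N -> same_contiguity_class M N.
  move=> MN; suff -> : M = N by exact: same_class_refl.
  case: M N MN => m mP [n nP] /= /funext mn; case: _ / mn in nP *.
  by congr SimplicialMap; exact: Prop_irrelevance.
move=> Ff Gg.
(* [N] exceeds every rank, so the switch at threshold [N] is [f], while at threshold 0 it is [g]. *)
pose N := (#|` fset_set [set: X]|).+1.
have rankN (x : X) : (rank x < N)%N.
  rewrite ltnS; apply: fsubset_leq_card; rewrite -fset_set_sub//.
  exact: finite_minimal_open.
have steps k : same_contiguity_class (monotone_map (@switch_monotone k))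
    (monotone_map (@switch_monotone 0)).
  elim: k => [|k IHk]; first exact: same_class_refl.
  apply: same_class_trans IHk; apply: contiguous_same_class.
  exact: switch_contiguous.
apply: (same_class_trans (g := monotone_map (@switch_monotone N))).
  by apply: same_fun => x; rewrite Ff /= /switch leqNgt rankN.
by apply: same_class_trans (steps N) _; apply: same_fun => x; rewrite Gg.
Qed.

End switch.

End comparable_maps.

(** * From homotopies to contiguity classes *)

Section homotopies.
Context (R : realType) {X Y : topologicalType}.
Hypotheses (finX : finite_set [set: X]) (finY : finite_set [set: Y]).
Variables (A : set X) (H : X * R -> Y).
Hypothesis (cH : {within A `*` `[0%R, 1%R], continuous H}).
Let I : set R := `[0%R, 1%R]%classic.

(** Continuity at [(x, t)] gives a box sent into the open set [minimal_open (H (x, t))]; its first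
    side, a neighbourhood of [x], contains every point below [x]. *)
Lemma homotopy_near_le x t : A x -> I t -> \forall s \near t, I s ->
  forall x', A x' -> spec_le x' x -> spec_le (H (x', s)) (H (x, t)).
Proof.
move=> Ax It; have /subspace_continuousP/(_ (x, t)) := cH.
move=> /(_ (conj Ax It)) /(_ (minimal_open (H (x, t)))).
have /[swap]/[apply] : nbhs (H (x, t)) (minimal_open (H (x, t))).
  apply: open_nbhs_nbhs; split; first exact: minimal_open_open.
  exact: minimal_open_id.
move=> [[B C] /= [Bx Ct] BC]; apply: filterS Ct => s Cs Is x' Ax' x'x.
apply/spec_leP; apply: (BC (x', s)); last by split.
split=> //=; move: Bx; rewrite nbhsE => -[B' [oB' B'x]]; apply.
exact: open_spec_le B'x.
Qed.

Lemma homotopy_monotone t : I t -> monotone_on A (fun x => H (x, t)).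
Proof.
move=> It x y Ax Ay xy.
by have /nbhs_singleton := homotopy_near_le Ay It; apply.
Qed.

(** As [A] is finite, the neighbourhoods of [t] obtained for its points can be intersected. *)
Lemma homotopy_near_le_fun t : I t -> \forall s \near t, I s ->
  forall x, A x -> spec_le (H (x, s)) (H (x, t)).
Proof.
move=> It.
have finA : finite_set A by exact: sub_finite_set finX.
have near_all : \forall s \near t, I s ->
    (\bigcap_(x in [set` fset_set A])
      [set s | spec_le (H (x, s)) (H (x, t))]) s.
  apply: filter_bigI_within => x; rewrite in_fset_set// inE => Ax.
  by apply: filterS (homotopy_near_le Ax It) => s + Is; apply.
apply: filterS near_all => s + Is x Ax => /(_ Is); apply.
by rewrite /= in_fset_set// inE.
Qed.

Lemma homotopy_same_class
    (F G : simplicial_map (subspace_complex A) (order_complex Y)) :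
  monotone_on A F -> monotone_on A G ->
  (forall x, A x -> H (x, 0%R) = F x) -> (forall x, A x -> H (x, 1%R) = G x) ->
  same_contiguity_class F G.
Proof.
move=> mF mG H0 H1.
have I0 : I 0%R by rewrite /I /= in_itv /= lexx ler01.
have I1 : I 1%R by rewrite /I /= in_itv /= lexx ler01.
pose P t := exists2 M : simplicial_map (subspace_complex A) (order_complex Y),
  M = (fun x => H (x, t)) :> (X -> Y) & same_contiguity_class F M.
suff [M ME FM] : P 1%R.
  (* [H] at time 1 agrees with [G] only on [A]; this makes the two maps comparable there, which
     suffices. *)
  apply: same_class_trans FM _.
  apply: (spec_le_same_class finX (homotopy_monotone I1) mG) => // x Ax.
  by rewrite H1.
apply: segment_locally_constant => [t It|].
  apply: filterS (homotopy_near_le_fun It) => s /[swap] Is /(_ Is) st.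
  have mt := homotopy_monotone It; have ms := homotopy_monotone Is.
  split=> -[M ME FM].
    exists (monotone_map mt) => //; apply: same_class_trans FM _.
    exact: (spec_le_same_class finX ms mt st).
  exists (monotone_map ms) => //; apply: same_class_trans FM _.
  by apply: same_class_sym; exact: (spec_le_same_class finX ms mt st).
exists (monotone_map (homotopy_monotone I0)) => //.
apply: (spec_le_same_class finX mF (homotopy_monotone I0)) => // x Ax.
by rewrite H0.
Qed.

End homotopies.

Theorem proposition30 (R : realType) (X Y : topologicalType)
    (finX : finite_set [set: X]) (finY : finite_set [set: Y])
    (connX : connected [set: X]) (connY : connected [set: Y])
    (T0X : kolmogorov_space X) (T0Y : kolmogorov_space Y)
    (f : X -> Y) (cf : continuous f) :
  (scat (order_complex_map cf) <= ls_cat R f)%E.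
Proof.
apply: le_least => n [U [oU covU nullU]].
have UK j : simplices (subspace_complex (U j)) `<=` simplices (order_complex X).
  by move=> s [].
exists (fun j => subspace_complex (U j)), UK; split.
  apply/seteqP; split=> [s [j _ /UK]//|s sc].
  (* Open sets are closed downwards, so a member of the cover containing the maximum of a chain
     contains the whole chain. *)
  have [m ms maxm] := chain_max finX sc.
  have : [set: X] m by []; rewrite -covU => -[j _ Ujm].
  by exists j => //; split=> // x /maxm xm; exact: open_spec_le Ujm.
move=> j; have [y [H [cH H0 H1]]] := nullU j.
have my : monotone_on (U j) (cst y : X -> Y) by move=> *; exact: spec_le_refl.
exists (monotone_map my).
  exists y => //; split; first by apply/fset0Pn; exists y; rewrite in_fset1.
  by move=> a b; rewrite !in_fset1 => /eqP-> /eqP->; left.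
apply: (homotopy_same_class finX finY cH) => // x x' _ _.
exact: spec_le_continuous.
Qed.
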